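(* Let $f:\mathbb{R}^{d_1}\times\mathbb{R}^{d_2}\to\mathbb{R}$ be a concave-convex differentiable function with globally Lipschitz gradient (with Lipschitz constant $K\in\mathbb{R}_{>0}$). For all $(x,y),(x',y')\in\mathbb{R}^{d_1}\times\mathbb{R}^{d_2}$, $$\begin{aligned}&(x-x')^T\big(\nabla_xf(x,y)-\nabla_xf(x',y')\big)+(y-y')^T\big(\nabla_yf(x',y')-\nabla_yf(x,y)\big)\\&\quad\le-\frac{1}{2K}\Big(\|\nabla_xf(x,y')-\nabla_xf(x',y')\|^2+\|\nabla_yf(x',y)-\nabla_yf(x',y')\|^2\\&\qquad\qquad+\|\nabla_xf(x',y)-\nabla_xf(x,y)\|^2+\|\nabla_yf(x,y')-\nabla_yf(x,y)\|^2\Big).\end{aligned}$$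
   Context: A function is concave-convex if it is concave in its first argument and convex in its second. $\|\cdot\|$ is the Euclidean norm; $\nabla_x f$, $\nabla_y f$ are the partial gradients with respect to the first and second arguments. *)

(* Defs.v *)
From HB Require Import structures.
From mathcomp Require Import all_boot all_order all_algebra.
From mathcomp Require Import all_classical all_reals all_analysis.

Set Implicit Arguments.
Unset Strict Implicit.
Unset Printing Implicit Defensive.

Import Order.TTheory GRing.Theory Num.Theory.
Import numFieldNormedType.Exports.

Local Open Scope classical_set_scope.
Local Open Scope convex_scope.
Local Open Scope ring_scope.

Definition dot (R : realType) (n : nat) (u v : 'cV[R]_n) : R :=
  (u^T *m v) 0 0.

(* The library norm `|u| on matrices is the sup norm, hence the separate
   Euclidean norm. *)
Definition enorm (R : realType) (n : nat) (u : 'cV[R]_n) : R :=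
  Num.sqrt (dot u u).

Definition grad (R : realType) (n : nat) (g : 'cV[R]_n -> R) (a : 'cV[R]_n) :
    'cV[R]_n :=
  \col_i 'D_(delta_mx i 0) g a.

Definition gradx (R : realType) (d1 d2 : nat)
    (f : 'cV[R]_d1 * 'cV[R]_d2 -> R) (x : 'cV[R]_d1) (y : 'cV[R]_d2) :
    'cV[R]_d1 :=
  grad (fun u => f (u, y)) x.

Definition grady (R : realType) (d1 d2 : nat)
    (f : 'cV[R]_d1 * 'cV[R]_d2 -> R) (x : 'cV[R]_d1) (y : 'cV[R]_d2) :
    'cV[R]_d2 :=
  grad (fun v => f (x, v)) y.

Definition concave_function (R : numFieldType) (E : lmodType R)
    (E' := convex_lmodType E) (D : set E') (f : E' -> R^o) :=
  forall (t : {i01 R}),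
    {in D &, forall (x y : E'), (f x <| t |> f y <= f (x <| t |> y))%R}.

Definition concave_convex (R : realType) (d1 d2 : nat)
    (f : 'cV[R]_d1 * 'cV[R]_d2 -> R) : Prop :=
  (forall y : 'cV[R]_d2,
     @concave_function R 'cV[R]_d1 setT (fun x => f (x, y))) /\
  (forall x : 'cV[R]_d1,
     @convex_function R 'cV[R]_d2 setT (fun y => f (x, y))).

(* R^d1 x R^d2 is identified with R^(d1 + d2) by stacking (col_mx), and both
   sides are measured in the Euclidean norm of R^(d1 + d2); the product norm
   on the pair type is a max of sup norms and would change the constant. *)
Definition lipschitz_gradient (R : realType) (d1 d2 : nat) (K : R)
    (f : 'cV[R]_d1 * 'cV[R]_d2 -> R) : Prop :=
  forall (x x' : 'cV[R]_d1) (y y' : 'cV[R]_d2),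
    enorm (col_mx (gradx f x y) (grady f x y)
           - col_mx (gradx f x' y') (grady f x' y'))
    <= K * enorm (col_mx x y - col_mx x' y').

(* Main.v *)
(* A convex function [g] with K-Lipschitz gradient satisfies
   g b >= g a + <grad g a, b - a> + |grad g b - grad g a|^2 / (2K).
   Applying this to -f(., y) and -f(., y') on the segment between x and x', and
   to f(x, .) and f(x', .) on the segment between y and y', and adding up the
   four inequalities, all the values of f cancel. *)
Require Import Defs.
From HB Require Import structures.
From mathcomp Require Import all_boot all_order all_algebra.
From mathcomp Require Import all_classical all_reals all_analysis.
From mathcomp Require Import ring lra.

Import Order.TTheory GRing.Theory Num.Theory.
Import numFieldNormedType.Exports.

Local Open Scope classical_set_scope.
Local Open Scope ring_scope.

Lemma dotC {R : realType} {n} (u v : 'cV[R]_n) : dot u v = dot v u.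
Proof.
rewrite /dot -[in LHS](trmxK (u^T *m v)) trmx_mul trmxK.
by rewrite mxE.
Qed.

Lemma dotDr {R : realType} {n} (u v w : 'cV[R]_n) :
  dot u (v + w) = dot u v + dot u w.
Proof. by rewrite /dot mulmxDr mxE. Qed.

Lemma dotZr {R : realType} {n} (u v : 'cV[R]_n) c :
  dot u (c *: v) = c * dot u v.
Proof. by rewrite /dot -scalemxAr mxE. Qed.

Lemma dotNr {R : realType} {n} (u v : 'cV[R]_n) : dot u (- v) = - dot u v.
Proof. by rewrite -scaleN1r dotZr mulN1r. Qed.

Lemma dot0r {R : realType} {n} (u : 'cV[R]_n) : dot u 0 = 0.
Proof. by rewrite /dot mulmx0 mxE. Qed.

Lemma dotDl {R : realType} {n} (u v w : 'cV[R]_n) :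
  dot (v + w) u = dot v u + dot w u.
Proof. by rewrite dotC dotDr !(dotC u). Qed.

Lemma dotZl {R : realType} {n} (u v : 'cV[R]_n) c :
  dot (c *: v) u = c * dot v u.
Proof. by rewrite dotC dotZr dotC. Qed.

Lemma dotNl {R : realType} {n} (u v : 'cV[R]_n) : dot (- v) u = - dot v u.
Proof. by rewrite dotC dotNr dotC. Qed.

Definition dotE := (@dotDl, @dotDr, @dotNl, @dotNr, @dotZl, @dotZr).

Lemma dot_sum {R : realType} {n} (u v : 'cV[R]_n) :
  dot u v = \sum_i u i 0 * v i 0.
Proof. by rewrite /dot mxE; apply: eq_bigr => i _; rewrite mxE. Qed.

Lemma dot_ge0 {R : realType} {n} (u : 'cV[R]_n) : 0 <= dot u u.
Proof. by rewrite dot_sum sumr_ge0// => i _; rewrite -expr2 sqr_ge0. Qed.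

Lemma dot_young {R : realType} {n} (u v : 'cV[R]_n) :
  2 * dot u v <= dot u u + dot v v.
Proof. by have := dot_ge0 (u - v); rewrite !dotE (dotC v); lra. Qed.

Lemma sqr_enorm {R : realType} {n} (u : 'cV[R]_n) : enorm u ^+ 2 = dot u u.
Proof. by rewrite sqr_sqrtr// dot_ge0. Qed.

Lemma dot_col_mx {R : realType} {m n} (a c : 'cV[R]_m) (b d : 'cV[R]_n) :
  dot (col_mx a b) (col_mx c d) = dot a c + dot b d.
Proof. by rewrite /dot tr_col_mx mul_row_col mxE. Qed.

(** The differential at [a] is linear, so it is determined by its values on the basis
    [delta_mx i 0], which are the entries of [grad g a]. *)
Lemma derive_dot_grad {R : realType} {n} {g : 'cV[R]_n -> R} {a : 'cV[R]_n}
  (v : 'cV[R]_n) : differentiable g a -> 'D_v g a = dot (grad g a) v.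
Proof.
move=> dg; rewrite deriveE// [v in LHS]matrix_sum_delta linear_sum dot_sum.
apply: eq_bigr => i _; rewrite big_ord1 linearZ mxE deriveE//=.
by rewrite mulrC.
Qed.

(** The difference quotient along the line at [t] is the one of [g] at [b + t *: v] in direction
    [v]. *)
Lemma is_derive_line {R : realType} {n} {g : 'cV[R]_n -> R} (b v : 'cV[R]_n)
  (t : R) : differentiable g (b + t *: v) ->
  is_derive t (1 : R) (fun s : R => g (b + s *: v))
    (dot (grad g (b + t *: v)) v).
Proof.
move=> dg.
have E : (fun h : R => h^-1 *: (((fun s : R => g (b + s *: v)) \o shift t)
    (h *: (1 : R)) - g (b + t *: v))) =
  (fun h : R => h^-1 *: ((g \o shift (b + t *: v)) (h *: v) - g (b + t *: v))).
  apply/funext => h /=; congr (_ *: (g _ - _)).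
  by rewrite [h *: _]mulr1 scalerDl addrCA addrA.
apply: DeriveDef; first by rewrite /derivable E; exact: diff_derivable.
by rewrite /derive E -derive_dot_grad.
Qed.

Lemma gradN {R : realType} {n} (g : 'cV[R]_n -> R) (a : 'cV[R]_n) :
  differentiable g a -> grad (- g) a = - grad g a.
Proof.
by move=> dg; apply/colP => i; rewrite !mxE deriveN//; exact: diff_derivable.
Qed.

(** The form that [lipschitz_gradient] takes on a slice of [f] with one argument fixed. *)
Definition grad_lipschitz {R : realType} {n} (K : R) (g : 'cV[R]_n -> R) :=
  forall a b, enorm (grad g a - grad g b) <= K * enorm (a - b).

Lemma grad_lipschitzN {R : realType} {n} {K : R} {g : 'cV[R]_n -> R} :
  (forall a, differentiable g a) -> grad_lipschitz K g ->
  grad_lipschitz K (- g).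
Proof.
move=> dg lip a b.
by rewrite !gradN// -opprD /enorm dotNl dotNr opprK; exact: lip.
Qed.

Lemma descent {R : realType} {n} {K : R} {g : 'cV[R]_n -> R}
    (b v : 'cV[R]_n) :
  0 < K -> (forall a, differentiable g a) -> grad_lipschitz K g ->
  g (b + v) <= g b + dot (grad g b) v + K / 2 * dot v v.
Proof.
move=> K0 dg lip.
(* The claim is [F 1 <= F 0]; it follows from the mean value theorem once [dF] is nonpositive on
   [[0, 1]]. *)
pose F t := g (b + t *: v) - t * dot (grad g b) v - t ^+ 2 * (K / 2 * dot v v).
pose dF t := dot (grad g (b + t *: v)) v - dot (grad g b) v - K * t * dot v v.
have FdF t : is_derive t (1 : R) F (dF t).
  have := is_derive_line b v t (dg _) => dl.
  apply: is_derive_eq.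
  rewrite /= !scaler0 !add0r /dF /GRing.scale/=; lra.
have dF0 t : 0 < t -> dF t <= 0.
  move=> t0; rewrite /dF.
  set w := grad g (b + t *: v) - grad g b.
  have Kt0 : 0 < K * t by rewrite mulr_gt0.
  have lw : dot w w <= (K * t) ^+ 2 * dot v v.
    have := lip (b + t *: v) b; rewrite addrAC subrr add0r -/w => lw.
    rewrite -sqr_enorm; apply: le_trans (lerXn2r 2 _ _ lw) _.
    - by rewrite nnegrE sqrtr_ge0.
    - by rewrite nnegrE mulr_ge0 ?sqrtr_ge0// ltW.
    - by rewrite !exprMn sqr_enorm dotZl dotZr !mulrA.
  (* AM-GM scaled by K t, in place of Cauchy-Schwarz *)
  have := dot_young w ((K * t) *: v); rewrite dotZl !dotZr => sq.
  have : K * t * (dot w v - K * t * dot v v) <= 0 by nra.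
  by rewrite pmulr_rle0// /w dotDl dotNl.
have [|c] := MVT_segment (@ler01 R) (fun t _ => FdF t).
  apply: derivable_within_continuous => t _.
  by have [] := FdF t.
rewrite in_itv/= subr0 mulr1 => /andP[c0 c1] FE.
have : dF c <= 0.
  (* The mean value point lies in the closed interval, and the bound [dF0] divides by [K * t]; at 0
     the derivative vanishes outright. *)
  have [->|cn0] := eqVneq c 0; last by apply: dF0; rewrite lt_neqAle eq_sym cn0.
  by rewrite /dF scale0r addr0 mulr0 mul0r subrr subr0.
rewrite -FE /F scale1r scale0r addr0; lra.
Qed.

Lemma descent_lower {R : realType} {n} {K : R} {g : 'cV[R]_n -> R}
    (b v : 'cV[R]_n) :
  0 < K -> (forall a, differentiable g a) -> grad_lipschitz K g ->
  g b + dot (grad g b) v - K / 2 * dot v v <= g (b + v).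
Proof.
move=> K0 dg lip.
have dNg a : differentiable (- g) a by exact: differentiableN.
have := descent b v K0 dNg (grad_lipschitzN dg lip).
by rewrite gradN// dotNl /= !fctE; lra.
Qed.

(** Convexity bounds [g (a + t *: v)] above by the chord and [descent_lower] bounds it below by the
    tangent minus [t ^+ 2 * q]. Dividing by [t] leaves an error [t * q], which is made arbitrarily
    small. *)
Lemma convex_above_tangent {R : realType} {n} {K : R} {g : 'cV[R]_n -> R}
    (a z : 'cV[R]_n) :
  0 < K -> (forall a, differentiable g a) -> grad_lipschitz K g ->
  @convex_function R 'cV[R]_n setT g ->
  g a + dot (grad g a) (z - a) <= g z.
Proof.
move=> K0 dg lip cvx; set v := z - a.
set q := K / 2 * dot v v.
have q0 : 0 <= q by rewrite mulr_ge0 ?dot_ge0// divr_ge0// ltW.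
have slope t : 0 < t -> t <= 1 -> dot (grad g a) v - t * q <= g z - g a.
  move=> t0 t1.
  have up := cvx (Itv01 (ltW t0) t1) z a (in_setT _) (in_setT _).
  have {up} : g (t *: z + (1 - t) *: a) <= t * g z + (1 - t) * g a := up.
  have -> : t *: z + (1 - t) *: a = a + t *: v.
    by rewrite scalerBl scale1r scalerBr addrCA.
  have := descent_lower a (t *: v) K0 dg lip.
  rewrite dotZl !dotZr => low up.
  have : t * (dot (grad g a) v - t * q - (g z - g a)) <= 0.
    by rewrite /q; lra.
  by rewrite pmulr_rle0// subr_le0.
apply/ler_addgt0Pr => e e0.
have eq0 : 0 < e + q by rewrite ltr_pwDl.
(* This [t] lies in []0, 1]] and gives [t * q <= e], also when [q = 0]. *)
have := slope (e / (e + q)); rewrite divr_gt0// ler_pdivrMr// mul1r lerDl.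
move=> /(_ isT q0); suff : e / (e + q) * q <= e by lra.
by rewrite mulrAC ler_pdivrMr// ler_pM2l// lerDr ltW.
Qed.

Lemma convex_above_quadratic {R : realType} {n} {K : R} {g : 'cV[R]_n -> R}
    (a b : 'cV[R]_n) :
  0 < K -> (forall a, differentiable g a) -> grad_lipschitz K g ->
  @convex_function R 'cV[R]_n setT g ->
  g a + dot (grad g a) (b - a) + 1 / (2 * K) * enorm (grad g b - grad g a) ^+ 2
  <= g b.
Proof.
move=> K0 dg lip cvx; set w := grad g b - grad g a.
(* z |-> g z - <grad g a, z> is minimal at a, so its value after a gradient
   step K^-1 w from b, bounded by descent, is at least its value at a *)
have := convex_above_tangent a (b - K^-1 *: w) K0 dg lip cvx.
have := descent b (- (K^-1 *: w)) K0 dg lip.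
rewrite sqr_enorm (addrAC b) (dotDr _ (b - a)) !dotNr dotNl opprK !dotZr dotZl.
have -> : dot w w = dot (grad g b) w - dot (grad g a) w by rewrite dotDl dotNl.
set p := dot (grad g b) w; set r := dot (grad g a) w => up low.
(* The step gains [K^-1 * dot w w] to first order and loses half of that to the quadratic term of
   [descent]. *)
have -> : 1 / (2 * K) * (p - r) = K^-1 * p - K^-1 * r
   - K / 2 * (K^-1 * (K^-1 * (p - r))) by field; rewrite gt_eqF.
lra.
Qed.

(** This is the convex case for [- g]: the squared norm of the gradient difference is unchanged by
    the sign. *)
Lemma concave_below_quadratic {R : realType} {n} {K : R} {g : 'cV[R]_n -> R}
    (a b : 'cV[R]_n) :
  0 < K -> (forall a, differentiable g a) -> grad_lipschitz K g ->
  @concave_function R 'cV[R]_n setT g ->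
  g b <=
  g a + dot (grad g a) (b - a) - 1 / (2 * K) * enorm (grad g b - grad g a) ^+ 2.
Proof.
move=> K0 dg lip cve.
have dNg c : differentiable (- g) c by exact: differentiableN.
have cvxN : @convex_function R 'cV[R]_n setT (- g).
  move=> t u v _ _; have := cve t u v (in_setT _) (in_setT _).
  by rewrite !fctE -convN lerN2.
have := convex_above_quadratic a b K0 dNg (grad_lipschitzN dg lip) cvxN.
rewrite !gradN// !sqr_enorm -opprD !dotNl dotNr !fctE; lra.
Qed.

Theorem theoremA1 (R : realType) (d1 d2 : nat)
    (f : 'cV[R]_d1 * 'cV[R]_d2 -> R) (K : R)
    (hK : 0 < K)
    (hcc : concave_convex f)
    (hdiff : forall p : 'cV[R]_d1 * 'cV[R]_d2, differentiable f p)
    (hlip : lipschitz_gradient K f)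
    (x x' : 'cV[R]_d1) (y y' : 'cV[R]_d2) :
  dot (x - x') (gradx f x y - gradx f x' y')
  + dot (y - y') (grady f x' y' - grady f x y)
  <= - (1 / (2 * K)) *
     (enorm (gradx f x y' - gradx f x' y') ^+ 2
      + enorm (grady f x' y - grady f x' y') ^+ 2
      + enorm (gradx f x' y - gradx f x y) ^+ 2
      + enorm (grady f x y' - grady f x y) ^+ 2).
Proof.
have [cve cvx] := hcc.
have dx v a : differentiable (fun u => f (u, v)) a.
  apply: (@differentiable_comp _ _ _ _ (fun u => (u, v)) f) => //.
have dy u a : differentiable (fun v => f (u, v)) a.
  apply: (@differentiable_comp _ _ _ _ (fun v => (u, v)) f) => //.
(* With [v] fixed the lower block of the argument difference is zero, and dropping the [grady] block
   only lowers the norm, so the constant [K] is kept. *)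
have lx v : grad_lipschitz K (fun u => f (u, v)).
  move=> a b; have := hlip a b v v.
  rewrite /enorm !opp_col_mx !add_col_mx !dot_col_mx subrr dot0r addr0.
  by apply: le_trans; rewrite ler_wsqrtr// lerDl dot_ge0.
have ly u : grad_lipschitz K (fun v => f (u, v)).
  move=> a b; have := hlip u u a b.
  rewrite /enorm !opp_col_mx !add_col_mx !dot_col_mx subrr dot0r add0r.
  by apply: le_trans; rewrite ler_wsqrtr// lerDr dot_ge0.
(* All four tangents are taken at [(x, y)] or [(x', y')], so the mixed points enter the gradient
   terms only through the squares. *)
have := concave_below_quadratic x x' hK (dx y) (lx y) (cve y).
have := concave_below_quadratic x' x hK (dx y') (lx y') (cve y').
have := convex_above_quadratic y y' hK (dy x) (ly x) (cvx x).
have := convex_above_quadratic y' y hK (dy x') (ly x') (cvx x').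
rewrite /gradx /grady !dotE !(dotC (grad _ _)); lra.
Qed.
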